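(* (One-premise and two-premise biconditional centering.) Let $A,B$ be logically independent events and let $A||B=(A|B)\wedge(B|A)$ be the biconditional event, which coincides with the conditional event $(AB)|(A\vee B)$. Then $\{A,B\}$ p-entails $A||B$, and $AB$ p-entails $A||B$. That is: the assessment $(1,1)$ on $\{A,B\}$ is coherent and every coherent assessment $(x,y,z)$ on $\{A,B,A||B\}$ with $x=y=1$ has $z=1$; and the assessment $1$ on $AB$ is coherent and every coherent assessment $(w,z)$ on $\{AB,A||B\}$ with $w=1$ has $z=1$.
   Context: Events are elements of a Boolean algebra with sure event $\Omega$ and impossible event $\emptyset$; $\overline{E}$ is negation, $EF$ is conjunction, and an event is identified with its $0/1$ indicator. $A,B$ are logically independent if $AB,\ A\overline B,\ \overline AB,\ \overline A\,\overline B$ are all $\neq\emptyset$. An unconditional event $E$ is identified with $E|\Omega$. The conjunction $(A|B)\wedge(B|A)$, with $P(A|B)=x_1$, $P(B|A)=x_2$ and prevision $z$, is the quantity equal to $\min\{AB+x_1\overline B,\ AB+x_2\overline A\}$ when $A\vee B$ is true and to $z$ otherwise; under coherence it is the conditional event $(AB)|(A\vee B)$, and its assessments are assessments $z=P[(AB)|(A\vee B)]$. Coherence (de Finetti). A real assessment $(p_1,\dots,p_n)$ on a finite family of conditional events $\{E_1|H_1,\dots,E_n|H_n\}$ ($H_i\neq\emptyset$) is coherent if for every nonempty $S\subseteq\{1,\dots,n\}$ and all real $s_i$ ($i\in S$), the set $D$ of values of the random gain $G=\sum_{i\in S}s_iH_i(E_i-p_i)$ on the constituents (nonimpossible atoms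 generated by the $E_i,H_i$) contained in $\bigvee_{i\in S}H_i$ satisfies $\min D\le0\le\max D$. A family is p-consistent if assigning probability $1$ to all its members is coherent; a p-consistent family p-entails a further conditional event if in every coherent assessment giving $1$ to all members of the family the further event also has probability $1$. *)

(* Defs.v *)
From mathcomp Require Import all_boot all_order all_algebra.
From mathcomp Require Import reals.

Set Implicit Arguments.
Unset Strict Implicit.
Unset Printing Implicit Defensive.

Import Order.TTheory GRing.Theory Num.Theory.
Local Open Scope ring_scope.

(* Events are the elements of a Boolean algebra [T : ctbDistrLatticeType d]:
   \top is the sure event, \bot the impossible one, ~` E the negation,
   E `&` F the conjunction and E `|` F the disjunction. *)

Definition logically_independent (d : Order.disp_t)
    (T : ctbDistrLatticeType d) (A B : T) : Prop :=
  [/\ (A `&` B)%O <> (\bot)%O, (A `&` ~` B)%O <> (\bot)%O,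
      (~` A `&` B)%O <> (\bot)%O & (~` A `&` ~` B)%O <> (\bot)%O].

(* [E %given H] is the conditional event E|H.  The requirement H <> \bot is
   not bundled here; it is imposed in [coherent] and [p_entails]. *)
Record cond_event (d : Order.disp_t) (T : ctbDistrLatticeType d) : Type :=
  CondEvent { ce_event : T; ce_given : T }.

Notation "E %given H" := (CondEvent E H) (at level 60, no associativity).

Definition unconditional (d : Order.disp_t) (T : ctbDistrLatticeType d)
  (E : T) : cond_event T := E %given (\top)%O.

Definition literal (d : Order.disp_t) (T : ctbDistrLatticeType d)
  (b : bool) (E : T) : T := if b then E else (~` E)%O.

(* The candidate atom in which E_i has truth value (c i).1 and H_i has truth
   value (c i).2; it may be impossible. *)
Definition atom_of (d : Order.disp_t) (T : ctbDistrLatticeType d) (n : nat)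
    (F : n.-tuple (cond_event T)) (c : {ffun 'I_n -> bool * bool}) : T :=
  (\meet_(i < n) (literal (c i).1 (ce_event (tnth F i))
                  `&` literal (c i).2 (ce_given (tnth F i))))%O.

Definition constituents (d : Order.disp_t) (T : ctbDistrLatticeType d)
    (n : nat) (F : n.-tuple (cond_event T)) : seq T :=
  [seq w <- [seq atom_of F c | c : {ffun 'I_n -> bool * bool}]
    | w != (\bot)%O].

(* The value of the indicator of E at w.  It is meant for a constituent w of a
   family generating E, so that w is below exactly one of E and ~` E. *)
Definition indicator (R : realType) (d : Order.disp_t)
  (T : ctbDistrLatticeType d) (E w : T) : R := (w <= E)%O%:R.

Definition gain (R : realType) (d : Order.disp_t) (T : ctbDistrLatticeType d)
    (n : nat) (F : n.-tuple (cond_event T)) (p : n.-tuple R)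
    (S : {set 'I_n}) (s : 'I_n -> R) (w : T) : R :=
  \sum_(i in S) s i * indicator R (ce_given (tnth F i)) w
                * (indicator R (ce_event (tnth F i)) w - tnth p i).

Definition gain_values (R : realType) (d : Order.disp_t)
    (T : ctbDistrLatticeType d) (n : nat) (F : n.-tuple (cond_event T))
    (p : n.-tuple R) (S : {set 'I_n}) (s : 'I_n -> R) : seq R :=
  [seq gain F p S s w | w <- constituents F
    & (w <= \join_(i in S) ce_given (tnth F i))%O].

Definition is_minimum (R : realType) (D : seq R) (m : R) : Prop :=
  m \in D /\ {in D, forall g, m <= g}.

Definition is_maximum (R : realType) (D : seq R) (m : R) : Prop :=
  m \in D /\ {in D, forall g, g <= m}.

Definition coherent (R : realType) (d : Order.disp_t)
    (T : ctbDistrLatticeType d) (n : nat)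
    (F : n.-tuple (cond_event T)) (p : n.-tuple R) : Prop :=
  (forall i : 'I_n, ce_given (tnth F i) <> (\bot)%O) /\
  (forall (S : {set 'I_n}) (s : 'I_n -> R), S != set0 ->
     exists m M : R,
       [/\ is_minimum (gain_values F p S s) m,
           is_maximum (gain_values F p S s) M & m <= 0 <= M]).

Definition p_consistent (R : realType) (d : Order.disp_t)
    (T : ctbDistrLatticeType d) (n : nat)
    (F : n.-tuple (cond_event T)) : Prop :=
  coherent F [tuple of nseq n (1 : R)].

Definition p_entails (R : realType) (d : Order.disp_t)
    (T : ctbDistrLatticeType d) (n : nat)
    (F : n.-tuple (cond_event T)) (C : cond_event T) : Prop :=
  [/\ p_consistent R F,
      ce_given C <> (\bot)%O &
      forall (p : n.-tuple R) (z : R),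
        coherent [tuple of rcons F C] [tuple of rcons p z] ->
        (forall i : 'I_n, tnth p i = 1) -> z = 1].

(* E|H as a random quantity, when assessed with probability z: the value of
   EH + z ~H. *)
Definition cond_quantity (R : realType) (d : Order.disp_t)
    (T : ctbDistrLatticeType d) (C : cond_event T) (z : R) (w : T) : R :=
  indicator R (ce_event C `&` ce_given C)%O w
  + z * indicator R (~` ce_given C)%O w.

(* The conjunction of A|B and B|A as a random quantity, where P(A|B) = x1,
   P(B|A) = x2 and the conjunction has prevision z. *)
Definition conj_quantity (R : realType) (d : Order.disp_t)
    (T : ctbDistrLatticeType d) (A B : T) (x1 x2 z : R) (w : T) : R :=
  if (w <= A `|` B)%O then
    Num.min (indicator R (A `&` B)%O w + x1 * indicator R (~` B)%O w)
            (indicator R (A `&` B)%O w + x2 * indicator R (~` A)%O w)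
  else z.

Definition biconditional (d : Order.disp_t) (T : ctbDistrLatticeType d)
  (A B : T) : cond_event T := (A `&` B)%O %given (A `|` B)%O.

(* Main.v *)
(** If the premises [E_i] are unconditional and their conjunction implies
    [C = E|H] in the strong sense [/\_i E_i <= E H], bet [-k] on each premise
    and [1 - z] on [C].  On the constituents where all premises are true the
    gain is [(1 - z)^2]; elsewhere it is at least [k - |1 - z| (1 + |z|)].  For
    [k] large, coherence (the gain cannot be everywhere positive) forces
    [z = 1]. *)
Require Import Defs.
From mathcomp Require Import all_boot all_order all_algebra.
From mathcomp Require Import reals lra.

Set Implicit Arguments.
Unset Strict Implicit.
Unset Printing Implicit Defensive.

Import Order.CTheory Order.TTheory GRing.Theory Num.Theory.
Local Open Scope ring_scope.

(** With its dual below, this turns one known gain value into the extrema that [coherent] demands;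
    p-consistency applies both at [0]. *)
Lemma seq_has_minimum (R : realType) (D : seq R) (x : R) :
  x \in D -> exists2 m, is_minimum D m & m <= x.
Proof.
move=> xD; suff [m mmin] : exists m, is_minimum D m.
  by exists m => //; exact: mmin.2.
elim: D {x xD} (x) (xD) => // y [|y' D] IH x _.
  by exists y; split=> [|g]; rewrite inE // => /eqP->.
have [m [mD mle]] := IH y' (mem_head _ _).
have [ym|my] := leP y m.
  exists y; split=> [|g]; first exact: mem_head.
  by rewrite inE => /predU1P[->//|/mle]; exact: le_trans.
exists m; split=> [|g]; first by rewrite inE mD orbT.
by rewrite inE => /predU1P[->|/mle//]; exact: ltW.
Qed.

Lemma seq_has_maximum (R : realType) (D : seq R) (x : R) :
  x \in D -> exists2 M, is_maximum D M & x <= M.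
Proof.
move=> xD.
have [m [mD mle] mx] := seq_has_minimum (map_f (@GRing.opp R) xD).
exists (- m); last by rewrite lerNr.
split=> [|g gD]; first by case/mapP: mD => y yD ->; rewrite opprK.
by rewrite lerNr; apply: mle; exact: map_f.
Qed.

Section Coherence.
Context (R : realType) (d : Order.disp_t) (T : ctbDistrLatticeType d).

Lemma coherent_gain_le0 (n : nat) (F : n.-tuple (cond_event T))
    (p : n.-tuple R) (S : {set 'I_n}) (s : 'I_n -> R) :
  coherent F p -> S != set0 ->
  exists2 w : T, (w <= \join_(i in S) ce_given (tnth F i))%O
               & gain F p S s w <= 0.
Proof.
move=> [_ coh] /(coh S s)[m [M [[/mapP[w + ->] _] _ /andP[gain_le0 _]]]].
by rewrite mem_filter => /andP[wS _]; exists w.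
Qed.

(** Bet [1] on the single conditional event: at some [w] below its conditioning event the gain, an
    indicator minus [tnth p i], is nonpositive. *)
Lemma coherent_ge0 (n : nat) (F : n.-tuple (cond_event T)) (p : n.-tuple R)
    (i : 'I_n) :
  coherent F p -> 0 <= tnth p i.
Proof.
move=> coh; have iS : [set i] != set0 by apply/set0Pn; exists i; exact: set11.
have [w] := coherent_gain_le0 (fun=> 1) coh iS.
rewrite big_set1 /gain big_set1 mul1r /indicator => -> /=.
by rewrite mul1r subr_le0; apply: le_trans; exact: ler0n.
Qed.

(** Where every [E_i H_i] is true, all bets at price [1] return exactly [0], so [0] lies between the
    extreme gains. *)
Lemma p_consistent_of_meet (n : nat) (F : n.-tuple (cond_event T)) :
  (\meet_(i < n) (ce_event (tnth F i) `&` ce_given (tnth F i)))%O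
    <> (\bot)%O -> p_consistent R F.
Proof.
set w := (\meet_(i < n) _)%O => w_neq0.
have wE i : (w <= ce_event (tnth F i) `&` ce_given (tnth F i))%O.
  exact: meets_inf.
have wH i : (w <= ce_given (tnth F i))%O.
  by move: (wE i); rewrite lexI => /andP[].
split=> [i Hi0|S s /set0Pn[i iS]].
  by apply: w_neq0; apply/eqP; rewrite -lex0 -Hi0.
suff D0 : 0 \in gain_values F [tuple of nseq n (1 : R)] S s.
  have [m ? ?] := seq_has_minimum D0.
  have [M ? ?] := seq_has_maximum D0.
  by exists m, M; split=> //; apply/andP.
apply/mapP; exists w; last first.
  rewrite /gain big1 // => j _; move: (wE j); rewrite lexI => /andP[wEj _].
  by rewrite /indicator wEj tnth_nseq subrr mulr0.
rewrite mem_filter (le_trans (wH i)) /=; last exact: joins_sup.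
rewrite mem_filter (introN eqP w_neq0) /=.
apply/mapP; exists [ffun=> (true, true)]; rewrite ?mem_enum //.
by apply: eq_bigr => j _; rewrite ffunE.
Qed.

Lemma p_entails_of_unconditional (n : nat) (F : n.-tuple (cond_event T))
    (C : cond_event T) :
  (forall i, ce_given (tnth F i) = (\top)%O) ->
  (\meet_(i < n) ce_event (tnth F i))%O <> (\bot)%O ->
  (\meet_(i < n) ce_event (tnth F i) <= ce_event C `&` ce_given C)%O ->
  p_entails R F C.
Proof.
move=> F1 F_neq0; rewrite lexI => /andP[FE FH]; split.
- apply: p_consistent_of_meet; congr (_ <> _): F_neq0.
  by apply: eq_bigr => i _; rewrite F1 meetx1.
- by move=> H0; apply: F_neq0; apply/eqP; rewrite -lex0 -H0.
move=> p z coh p1.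
(* The product bounds the absolute value of the gain on [C]; the added [1] makes one lost premise
   outweigh it strictly. In [s], [ord_max] is the index of [C], appended by [rcons]. *)
pose k := 1 + `|1 - z| * (1 + `|z|).
pose s (i : 'I_n.+1) : R := if i == ord_max then 1 - z else - k.
have TN0 : [set: 'I_n.+1] != set0.
  by apply/set0Pn; exists ord_max; rewrite inE.
have k_gt0 : 0 < k by rewrite ltr_wpDr // mulr_ge0 // addr_ge0.
have [w _] := coherent_gain_le0 s coh TN0.
have nthl U (t : n.-tuple U) x (i : 'I_n) :
    tnth [tuple of rcons t x] (widen_ord (leqnSn n) i) = tnth t i.
  by rewrite !(tnth_nth x) /= nth_rcons size_tuple ltn_ord.
have nthr U (t : n.-tuple U) x : tnth [tuple of rcons t x] ord_max = x.
  by rewrite (tnth_nth x) /= nth_rcons size_tuple ltnn eqxx.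
rewrite /gain (eq_bigl predT) => [|i]; last by rewrite inE.
rewrite big_ord_recr /= !nthr /s eqxx.
under eq_bigr => i _.
  rewrite !nthl F1 p1 -val_eqE /= ltn_eqF // {1}/indicator lex1 mulr1 /indicator.
  over.
(* Betting against a premise at price [1] yields [0] if it is true and [k] if it is false. *)
have term_ge0 i : 0 <= - k * ((w <= ce_event (tnth F i))%O%:R - 1).
  by case: (w <= _)%O; rewrite ?subrr ?mulr0 // sub0r mulrNN mulr1 ltW.
have [wF|/forallPn[i wi]] := boolP [forall i, (w <= ce_event (tnth F i))%O].
  have wmeet : (w <= \meet_(i < n) ce_event (tnth F i))%O.
    by apply/meetsP => i _; exact: (forallP wF).
  rewrite /indicator (le_trans wmeet FE) (le_trans wmeet FH) mulr1 => gain_le0.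
  have sq_le0 : (1 - z) * (1 - z) <= 0.
    by apply: le_trans gain_le0; rewrite lerDr sumr_ge0.
  apply/esym/eqP; rewrite -subr_eq0 -sqrf_eq0 eq_le sqr_ge0 andbT.
  by rewrite expr2.
rewrite leNgt => /negP[].
(* The false premise [i] contributes [k], the others are nonnegative; it remains to see that the
   term of [C] exceeds [- k]. *)
rewrite (bigD1 i) //= (negPf wi) sub0r mulrNN mulr1 -addrA addrCA.
rewrite ltr_wpDl ?sumr_ge0 // /indicator.
have : `|(1 - z) * (w <= ce_given C)%O%:R * ((w <= ce_event C)%O%:R - z)|
    <= `|1 - z| * (1 + `|z|).
  rewrite !normrM ler_pM ?mulr_ge0 //.
    by rewrite ler_piMr //; case: (w <= _)%O; rewrite ?normr1 ?normr0.
  apply: le_trans (ler_normB _ _) _.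
  by rewrite lerD2r; case: (w <= _)%O; rewrite ?normr1 ?normr0.
by rewrite ler_norml /k => /andP[lb _]; lra.
Qed.

Lemma constituent_neq0 (n : nat) (F : n.-tuple (cond_event T)) (w : T) :
  w \in constituents F -> w != (\bot)%O.
Proof. by rewrite mem_filter => /andP[]. Qed.

(** An atom has one of the two literals of each [E_i] among its meetands. An arbitrary element of
    [T] may lie below neither. *)
Lemma constituent_decides (n : nat) (F : n.-tuple (cond_event T)) (w : T)
    (i : 'I_n) :
  w \in constituents F ->
  (w <= ce_event (tnth F i))%O || (w <= ~` ce_event (tnth F i))%O.
Proof.
rewrite mem_filter => /andP[_ /mapP[c _ ->]].
have : (atom_of F c <= literal (c i).1 (ce_event (tnth F i)))%O.
  have /meetsP/(_ i isT) := lexx (atom_of F c).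
  by rewrite lexI => /andP[].
by case: (c i).1 => /= ->; rewrite ?orbT.
Qed.

(** Below both [E] and its negation there is only [\bot]; so at a constituent negation acts on truth
    values as Boolean negation. *)
Lemma le_compl_decided (w E : T) :
  w != (\bot)%O -> (w <= E)%O || (w <= ~` E)%O ->
  (w <= ~` E)%O = ~~ (w <= E)%O.
Proof.
move=> w_neq0; have [wE _|_ /= ->//] := boolP (w <= E)%O.
by apply: contraNF w_neq0 => wCE; rewrite -lex0 -(meetxC E) lexI wE.
Qed.

End Coherence.

Theorem mainTheorem11 (R : realType) (d : Order.disp_t)
    (T : ctbDistrLatticeType d) (A B : T) :
  logically_independent A B ->
  [/\ (forall x1 x2 z : R,
         coherent [tuple A %given B; B %given A] [tuple x1; x2] ->
         {in constituents [tuple A %given B; B %given A], forall w : T,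
            conj_quantity A B x1 x2 z w
            = cond_quantity (biconditional A B) z w}),
      p_entails R [tuple unconditional A; unconditional B]
        (biconditional A B) &
      p_entails R [tuple unconditional (A `&` B)%O]
        (biconditional A B)].
Proof.
case=> AB_neq0 _ _ _.
have AB_le : (A `&` B <= (A `&` B) `&` (A `|` B))%O.
  by rewrite lexI lexx (le_trans (leIl _ _) (leUl _ _)).
split.
- move=> x1 x2 z coh w wc.
  have x1_ge0 : 0 <= x1 := coherent_ge0 ord0 coh.
  have x2_ge0 : 0 <= x2 := coherent_ge0 ord_max coh.
  have w_neq0 := constituent_neq0 wc.
  have dA := constituent_decides ord0 wc.
  have dB := constituent_decides ord_max wc.
  rewrite /= in dA dB.
  have CA := le_compl_decided w_neq0 dA.
  have CB := le_compl_decided w_neq0 dB.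
  have CU : (w <= ~` (A `|` B))%O = ~~ (w <= A)%O && ~~ (w <= B)%O.
    by rewrite complU lexI CA CB.
  (* In general [w] can lie below a join and below neither part. Here failing both [A] and [B] puts
     [w] below the negation of the join. *)
  have U : (w <= A `|` B)%O = (w <= A)%O || (w <= B)%O.
    have [wA|nA] := boolP (w <= A)%O; first by rewrite (le_trans wA) ?leUl.
    have [wB|nB] := boolP (w <= B)%O; first by rewrite (le_trans wB) ?leUr.
    apply/negbTE; rewrite -le_compl_decided //; first by rewrite CU nA nB.
    by rewrite CU nA nB orbT.
  (* Everything is now a truth table in [A] and [B]. When exactly one holds, the minimum is between
     [0] and [x1] or [x2], and nonnegativity makes it [0]. *)
  rewrite /conj_quantity /cond_quantity /indicator /= !lexI CU U CA CB.
  case: (w <= A)%O; case: (w <= B)%O => /=;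
    rewrite ?mulr0 ?mulr1 ?addr0 ?add0r ?minxx //.
  + by rewrite min_r.
  + by rewrite min_l.
- apply: p_entails_of_unconditional.
  + by case=> [[|[|]]].
  + by rewrite 2!big_ord_recl big_ord0 meetx1.
  + by rewrite 2!big_ord_recl big_ord0 meetx1.
- apply: p_entails_of_unconditional.
  + by case=> [[|]].
  + by rewrite big_ord_recl big_ord0 meetx1.
  + by rewrite big_ord_recl big_ord0 meetx1.
Qed.
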